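(* Let $0\le l<n$ be integers. The poset $R_{n,l}$ is rank-log-concave. It also admits a normalized flow, and hence is strongly Sperner.
   Context: $R_{n,l}$ is the poset whose elements are $(l+1)$-tuples $(A_1,\dots,A_{l+1})$ of nonempty subsets of $[n]=\{1,\dots,n\}$ such that $\max(A_i)<\min(A_{i+1})$ for all $i\in[l]$, ordered by componentwise containment. It is graded with ranks labeled $1$ to $n-l$, the rank of $(A_1,\dots,A_{l+1})$ being $|A_1\cup\cdots\cup A_{l+1}|-l$. For a finite graded poset $P$ with ranks labeled $1,\dots,d$, $W_r$ denotes the number of elements of rank $r$; $P$ is rank-log-concave if $W_{i-1}W_{i+1}\le W_i^2$ for $2\le i\le d-1$. $P$ is $j$-Sperner if for all antichains $A_1,\dots,A_j$ of $P$, $|A_1\cup\cdots\cup A_j|\le\max_{1\le r_1<\cdots<r_j\le d}(W_{r_1}+\cdots+W_{r_j})$; $P$ is strongly Sperner if it is $j$-Sperner for all $j\ge1$. A normalized flow on $P$ is a function $f$ from the cover relations of $P$ to $\mathbb{R}_{\ge0}$ such that for each $1\le r\le d-1$: (NF1) $\sum_{y:\,x\lessdot y}f(x\lessdot y)$ is the same positive number for all $x$ of rank $r$; and (NF2) $\sum_{x:\,x\lessdot y}f(x\lessdot y)$ is the same positive number for all $y$ of rank $r+1$. *)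

(* Defs.v *)
From HB Require Import structures.
From mathcomp Require Import all_boot all_order all_algebra.
From mathcomp Require Import reals.

Set Implicit Arguments.
Unset Strict Implicit.
Unset Printing Implicit Defensive.

Import Order.TTheory GRing.Theory Num.Theory.

Definition covers d (T : finPOrderType d) (x y : T) : bool :=
  (x < y)%O && [forall z, ~~ ((x < z)%O && (z < y)%O)].

Definition antichain d (T : finPOrderType d) (A : {set T}) : Prop :=
  {in A &, forall x y, (x <= y)%O -> x = y}.

(* The ranks of a graded poset are labeled 1, ..., height. *)
HB.mixin Record isGraded (d : Order.disp_t) T of Order.FinPOrder d T := {
  height : nat;
  rank : T -> nat;
  rank_minimal : forall x : T, (forall y : T, (y <= x)%O -> y = x) ->
    rank x = 1%N;
  rank_maximal : forall x : T, (forall y : T, (x <= y)%O -> y = x) ->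
    rank x = height;
  rank_covers : forall x y : T, covers x y -> rank y = (rank x).+1
}.

#[short(type="gradedPosetType")]
HB.structure Definition GradedPoset (d : Order.disp_t) :=
  {T of isGraded d T & Order.FinPOrder d T}.

Arguments height {d} s.

Section GradedPosetTheory.
Context {d : Order.disp_t} (T : gradedPosetType d).

Definition whitney (r : nat) : nat := #|[set x : T | rank x == r]|.

Definition rank_log_concave : Prop :=
  forall i : nat, (2 <= i <= (height T).-1)%N ->
    (whitney i.-1 * whitney i.+1 <= whitney i ^ 2)%N.

(* A choice of ranks 1 <= r_1 < ... < r_j <= height T is encoded as a set S of
   j elements of 'I_(height T), the index r standing for the rank r.+1.  When
   j > height T there is no such choice, and all the ranks are taken: the
   bound is then #|T|. *)
Definition Sperner (j : nat) : Prop :=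
  forall A : 'I_j -> {set T}, (forall i, antichain (A i)) ->
    (#|\bigcup_(i < j) A i| <=
       \max_(S : {set 'I_(height T)} | #|S| == minn j (height T))
         \sum_(r in S) whitney r.+1)%N.

Definition strongly_Sperner : Prop := forall j : nat, (1 <= j)%N -> Sperner j.

(* Only the values of f on pairs (x, y) with covers x y are relevant. *)
Definition normalized_flow (R : realType) (f : T -> T -> R) : Prop :=
  [/\ forall x y, covers x y -> (0 <= f x y)%R,
      forall r, (1 <= r <= (height T).-1)%N ->
        exists2 c : R, (0 < c)%R & forall x : T, rank x = r ->
          (\sum_(y | covers x y) f x y)%R = c
    & forall r, (1 <= r <= (height T).-1)%N ->
        exists2 c : R, (0 < c)%R & forall y : T, rank y = r.+1 ->
          (\sum_(x | covers x y) f x y)%R = c].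

Definition has_normalized_flow (R : realType) : Prop :=
  exists f : T -> T -> R, normalized_flow f.

End GradedPosetTheory.

(* The ground set [n] is 'I_n = {0, ..., n - 1}.  The value n for the minimum
   of the empty set is irrelevant below. *)
Definition setmax n (A : {set 'I_n}) : nat := \max_(a in A) a.
Definition setmin n (A : {set 'I_n}) : nat := \big[minn/n]_(a in A) a.

Definition block_tuple n l (A : {ffun 'I_l.+1 -> {set 'I_n}}) : bool :=
  [forall i, A i != set0] &&
  [forall i : 'I_l.+1, forall j : 'I_l.+1,
     (j == i.+1 :> nat) ==> (setmax (A i) < setmin (A j))%N].

Record Rposet (n l : nat) := RPoset {
  blocks :> {ffun 'I_l.+1 -> {set 'I_n}};
  blocksP : block_tuple blocks
}.

HB.instance Definition _ n l := [isSub for @blocks n l].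
HB.instance Definition _ n l := [Finite of Rposet n l by <:].

Fact Rposet_display : Order.disp_t. Proof. exact: Order.Disp tt tt. Qed.

Section RposetOrder.
Context {n l : nat}.
Implicit Types A B C : Rposet n l.

Definition Rposet_le A B : bool := [forall i, A i \subset B i].

Fact Rposet_le_refl : reflexive Rposet_le.
Proof. by move=> A; apply/forallP. Qed.

Fact Rposet_le_anti : antisymmetric Rposet_le.
Proof.
move=> A B /andP[/forallP AB /forallP BA]; apply/val_inj/ffunP => i.
by apply/eqP; rewrite eqEsubset AB BA.
Qed.

Fact Rposet_le_trans : transitive Rposet_le.
Proof.
move=> B A C /forallP AB /forallP BC.
by apply/forallP => i; apply: subset_trans (BC i).
Qed.

HB.instance Definition _ := Order.Le_isPOrder.Build Rposet_display (Rposet n l)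
  Rposet_le_refl Rposet_le_anti Rposet_le_trans.

End RposetOrder.

Definition Rposet_rank n l (A : Rposet n l) : nat := #|\bigcup_i A i| - l.

Section RposetGraded.
Context {n l : nat}.
Implicit Types (A B : Rposet n l) (F : {ffun 'I_l.+1 -> {set 'I_n}}).

Lemma setmax_lt_setminP (X Y : {set 'I_n}) : X != set0 -> Y != set0 ->
  reflect {in X & Y, forall x y : 'I_n, (x < y)%N} (setmax X < setmin Y)%N.
Proof.
move=> X0 Y0; apply: (iffP idP) => [lt_XY x y xX yY | lt_XY].
  have le_x : (x <= setmax X)%N.
    exact: (leq_bigmax_cond (F := @nat_of_ord n)).
  apply: leq_ltn_trans le_x (leq_trans lt_XY _).
  rewrite /setmin; elim: (index_enum _) (mem_index_enum y) => // z s IHs.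
  rewrite inE big_cons => /predU1P[<-|/IHs le_y]; first by rewrite yY geq_minl.
  by case: ifP => // _; apply: leq_trans (geq_minr _ _) le_y.
case/set0Pn: X0 => x xX.
have X_gt0 : (0 < #|[in X]|)%N by apply/card_gt0P; exists x.
have [z zX maxX] := eq_bigmax_cond (@nat_of_ord n) X_gt0.
rewrite (_ : setmax X = z); last exact: maxX.
rewrite /setmin; elim/big_rec: _ => [|y m yY IH]; first exact: ltn_ord.
by rewrite leq_min lt_XY.
Qed.

Lemma block_tupleP F :
  reflect ((forall i, F i != set0) /\
           (forall i j : 'I_l.+1, (i < j)%N ->
              {in F i & F j, forall x y : 'I_n, (x < y)%N}))
          (block_tuple F).
Proof.
apply: (iffP andP) => [[/forallP F0 /forallP Flt]|[F0 Flt]]; last first.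
  split; first exact/forallP.
  apply/forallP => i; apply/forallP => j; apply/implyP => /eqP ij.
  by apply/setmax_lt_setminP => //; apply: Flt; rewrite ij.
split=> // i [j ltj] /= ij x y.
elim: j ltj ij y => // j IHj ltj ij y xi yj.
have ltj' : (j < l.+1)%N by apply: ltnW.
have step z : z \in F (Ordinal ltj') -> (z < y)%N.
  move=> zj; have /implyP/(_ (eqxx _)) := forallP (Flt (Ordinal ltj')) (Ordinal ltj).
  by move/(setmax_lt_setminP (F0 _) (F0 _)); apply.
move: ij; rewrite ltnS leq_eqVlt => /predU1P[ij|ij].
  by apply: step; rewrite (_ : Ordinal ltj' = i) //; apply: val_inj.
have [z zj] := set0Pn _ (F0 (Ordinal ltj')).
exact: ltn_trans (IHj ltj' ij z xi zj) (step z zj).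
Qed.

Lemma block_tuple_sub F B : (forall i, F i != set0) ->
  (forall i, F i \subset B i) -> block_tuple F.
Proof.
move=> F0 sFB; apply/block_tupleP; split=> // i j ij x y xi yj.
have [_ Blt] := block_tupleP _ (blocksP B).
exact: Blt ij _ _ (subsetP (sFB i) _ xi) (subsetP (sFB j) _ yj).
Qed.

Lemma block_inj A i j x : x \in A i -> x \in A j -> i = j.
Proof.
have [_ Alt] := block_tupleP _ (blocksP A) => xi xj.
apply: val_inj; case: (ltngtP i j) => // ij.
  by have := Alt _ _ ij _ _ xi xj; rewrite ltnn.
by have := Alt _ _ ij _ _ xj xi; rewrite ltnn.
Qed.

Lemma card_blocks A : #|\bigcup_i A i| = \sum_i #|A i|.
Proof.
rewrite -sum1_card partition_disjoint_bigcup => [|i j ij].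
  by apply: eq_bigr => i _; rewrite sum1_card.
rewrite -setI_eq0; apply/set0Pn => -[x /setIP[xi xj]].
by rewrite (block_inj xi xj) eqxx in ij.
Qed.

Lemma card_blocks_gt A : (l < #|\bigcup_i A i|)%N.
Proof.
rewrite card_blocks -[X in (X <= _)%N]card_ord -sum1_card; apply: leq_sum => i _.
by have [A0 _] := block_tupleP _ (blocksP A); rewrite card_gt0.
Qed.

Lemma Rposet_leP A B :
  reflect (forall i, A i \subset B i) (A <= B)%O.
Proof. exact: forallP. Qed.

Lemma Rposet_del B i b : b \in B i -> B i != [set b] ->
  exists2 B' : Rposet n l, (B' < B)%O &
    forall j, B' j = B j :\ b.
Proof.
move=> bi nb; have [B0 _] := block_tupleP _ (blocksP B).
pose F := [ffun j => B j :\ b].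
have FB j : F j \subset B j by rewrite ffunE subD1set.
have F0 j : F j != set0.
  rewrite ffunE; apply: contraNneq nb => Bj; have /set0Pn[y yj] := B0 j.
  have yb : y = b by apply/eqP; apply: contraT => nyb;
    rewrite -(in_set0 y) -Bj !inE nyb.
  rewrite yb in yj; rewrite (block_inj bi yj) eqEsubset sub1set yj andbT.
  by rewrite -setD_eq0 Bj.
pose B' := RPoset (block_tuple_sub F0 FB).
have leB'B : (B' <= B)%O by apply/Rposet_leP => j; apply: FB.
exists B'; last by move=> j; rewrite ffunE.
rewrite lt_neqAle leB'B andbT; apply: contraTneq bi => <-.
by rewrite /= ffunE !inE eqxx.
Qed.

Fact Rposet_rank_minimal A :
  (forall B, (B <= A)%O -> B = A) -> Rposet_rank A = 1%N.
Proof.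
move=> minA; rewrite /Rposet_rank card_blocks (eq_bigr (fun=> 1%N)) => [|i _].
  by rewrite sum1_card card_ord subSn ?subnn.
have [A0 _] := block_tupleP _ (blocksP A); have /set0Pn[b bi] := A0 i.
have [->|nb] := eqVneq (A i) [set b]; first by rewrite cards1.
have [B ltBA _] := Rposet_del bi nb.
by move: (ltBA); rewrite (minA B (ltW ltBA)) ltxx.
Qed.

Fact Rposet_rank_maximal A :
  (forall B, (A <= B)%O -> B = A) -> Rposet_rank A = n - l.
Proof.
move=> maxA; rewrite /Rposet_rank; congr (_ - l).
suff -> : \bigcup_i A i = [set: 'I_n] by rewrite cardsT card_ord.
have [A0 Alt] := block_tupleP _ (blocksP A).
apply/setP => a; rewrite inE; apply: contraT => aA.
have aNA j : a \notin A j by apply: contra aA => aj; apply/bigcupP; exists j.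
(* i: the last block with an element below a, or the first block if none *)
pose P (i : 'I_l.+1) := [exists x in A i, (x < a)%N].
have [i [ilo ihi]] : exists i : 'I_l.+1,
    (forall j : 'I_l.+1, (j < i)%N -> {in A j, forall x : 'I_n, (x < a)%N}) /\
    (forall j : 'I_l.+1, (i < j)%N -> {in A j, forall x : 'I_n, (a < x)%N}).
  have ngt j x : x \in A j -> ~~ P j -> (a < x)%N.
    move=> xj /existsPn/(_ x); rewrite xj /= -leqNgt leq_eqVlt.
    by case/predU1P=> // /val_inj ax; move: (aNA j); rewrite ax xj.
  have [i0 Pi0|noP] := pickP P; last first.
    by exists ord0; split=> // j _ x xj; apply: ngt xj _; rewrite noP.
  case: (arg_maxnP (fun i : 'I_l.+1 => val i) Pi0) => i Pi imax.
  exists i; split=> j ij x xj.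
    case/exists_inP: Pi => y yi ya.
    exact: ltn_trans (Alt _ _ ij _ _ xj yi) ya.
  by apply: ngt xj _; apply: contraTN ij => /imax; rewrite -leqNgt.
pose F := [ffun j => if j == i then a |: A j else A j].
have AF j : A j \subset F j by rewrite ffunE; case: ifP => // _; apply: subsetU1.
have FP : block_tuple F.
  apply/block_tupleP; split=> [j|j k jk x y].
    have /set0Pn[x xj] := A0 j; apply/set0Pn; exists x; exact: subsetP (AF j) _ xj.
  rewrite !ffunE; case: eqVneq => [ji|_]; case: eqVneq => [ki|_].
  - by rewrite ji ki ltnn in jk.
  - rewrite ji in jk *; rewrite !inE => /predU1P[->|xi] yk; first exact: ihi jk _ yk.
    exact: Alt jk _ _ xi yk.
  - rewrite ki in jk *; rewrite !inE => xj /predU1P[->|yi]; first exact: ilo jk _ xj.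
    exact: Alt jk _ _ xj yi.
  - exact: Alt jk x y.
have leAF : (A <= RPoset FP)%O by apply/Rposet_leP => j; apply: AF.
have FA := maxA _ leAF.
have := aNA i; rewrite -FA /= ffunE eqxx => /negP[]; exact: setU11.
Qed.

Fact Rposet_rank_covers A B : covers A B -> Rposet_rank B = (Rposet_rank A).+1.
Proof.
case/andP=> ltAB /forallP noZ; have /Rposet_leP sAB := ltW ltAB.
have [A0 _] := block_tupleP _ (blocksP A).
have /existsP[i nAB] : [exists i, ~~ (B i \subset A i)].
  apply: contraLR ltAB => /existsPn BA; rewrite lt_neqAle negb_and negbK.
  apply/orP; left; apply/eqP/val_inj/ffunP => j.
  by apply/eqP; rewrite eqEsubset sAB /=; have:= BA j; rewrite negbK.
have /subsetPn[b bB bA] := nAB.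
have nb : B i != [set b].
  apply: contraNneq bA => Bi; have /set0Pn[y yi] := A0 i.
  by have := subsetP (sAB i) _ yi; rewrite Bi inE => /eqP<-.
have bNA j : b \notin A j.
  apply: contra bA => bj.
  by rewrite (block_inj bB (subsetP (sAB j) _ bj)).
have [B' ltB'B B'E] := Rposet_del bB nb.
have leAB' : (A <= B')%O.
  by apply/Rposet_leP => j; rewrite B'E subsetD1 sAB bNA.
have AB' : A = B'.
  have := noZ B'; rewrite ltB'B andbT lt_neqAle leAB' andbT negbK.
  by move/eqP.
have bU : b \in \bigcup_i B i by apply/bigcupP; exists i.
have UE : \bigcup_i A i = (\bigcup_i B i) :\ b.
  rewrite AB'; apply/setP => x; rewrite in_setD1; apply/bigcupP/andP.
    by case=> j _; rewrite B'E in_setD1 => /andP[nxb xj]; split=> //;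
      apply/bigcupP; exists j.
  by case=> nxb /bigcupP[j _ xj]; exists j; rewrite ?B'E ?in_setD1 ?nxb.
have := card_blocks_gt A.
by rewrite /Rposet_rank (cardsD1 b (\bigcup_i B i)) bU -UE => /ltnW; apply: subSn.
Qed.

HB.instance Definition _ := isGraded.Build Rposet_display (Rposet n l)
  Rposet_rank_minimal Rposet_rank_maximal Rposet_rank_covers.

End RposetGraded.

(* Main.v *)
Require Import Defs.
From mathcomp Require Import all_boot all_order all_algebra.
From mathcomp Require Import reals.
From mathcomp Require Import zify ring lra.

(* Let A have union U with m elements.  For every s in U and every b outside U,
   add b to the block containing the neighbour of b in U that lies on the same
   side of b as s; the flow f(A, B) counts the pairs (s, b) leading from A to B.
   Each pair leads to exactly one B, so the flow out of A is m (n - m).  Given B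
   whose union V has m + 1 elements, a point s of V and a block B_i, deleting
   b from B_i is reversed by s unless b is the element of B_i nearest to s; so
   the flow into B is (m + 1) times the sum of the |B_i| - 1, that is,
   (m + 1) (m - l).  Double counting the flow yields
     W_r m (n - m) = W_(r+1) (m + 1) r   with m = r + l,
   whence log-concavity.  A normalized flow gives the LYM inequality for
   antichains; summing it over j antichains bounds by j the sum of the densities
   of their union in the ranks, which implies the Sperner property. *)

Set Implicit Arguments.
Unset Strict Implicit.
Unset Printing Implicit Defensive.

Import Order.TTheory GRing.Theory Num.Theory.

(** * Ranks, covers and double counting in a graded poset *)

Section GradedPosetFlow.
Context {d : Order.disp_t} (T : gradedPosetType d).
Implicit Types x y z w : T.

(** Among the elements below [y], one with the most elements below it is covered by [y]: anything
    strictly between would have more. *)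
Lemma exists_covers_below x y : (x < y)%O -> exists w, covers w y.
Proof.
move=> xy; pose P w := (w < y)%O; have Px : P x by [].
case: (arg_maxnP (fun w => #|[set u : T | (u < w)%O]|) Px) => w wy wmax.
exists w; rewrite /covers [(w < y)%O]wy; apply/forallP => z; apply/negP => /andP[wz zy].
have := wmax z zy; rewrite /geq /= leqNgt => /negP[]; apply/proper_card/properP; split.
  by apply/subsetP => u; rewrite !inE => /lt_trans; apply.
by exists w; rewrite !inE ?wz ?ltxx.
Qed.

Lemma exists_covers_above x y : (x < y)%O -> exists w, covers x w.
Proof.
move=> xy; pose P w := (x < w)%O; have Py : P y by [].
case: (arg_minnP (fun w => #|[set u : T | (u < w)%O]|) Py) => w xw wmin.
exists w; rewrite /covers [(x < w)%O]xw; apply/forallP => z; apply/negP => /andP[xz zw].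
have := wmin z xz; rewrite leqNgt => /negP[]; apply/proper_card/properP; split.
  by apply/subsetP => u; rewrite !inE => /lt_trans; apply.
by exists z; rewrite !inE ?zw ?ltxx.
Qed.

Lemma rank_gt0 x : (0 < rank x)%N.
Proof.
case: (pickP [pred w | covers w x]) => [w /rank_covers-> //|min_x].
rewrite rank_minimal // => y; rewrite le_eqVlt => /predU1P[//|].
by case/exists_covers_below => w; rewrite [covers _ _]min_x.
Qed.

Lemma rank_le_height x : (rank x <= height T)%N.
Proof.
have [k] := ubnP #|[set u : T | (x < u)%O]|; elim: k x => // k IHk x ltk.
case: (pickP [pred w | covers x w]) => [w /= xw|max_x].
  apply: ltnW; rewrite -(rank_covers _ _ xw); apply: IHk; move: xw => /andP[xw _].
  rewrite ltnS in ltk; apply: leq_trans ltk; apply/proper_card/properP; split.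
    by apply/subsetP => u; rewrite !inE; apply: lt_trans.
  by exists w; rewrite !inE ?xw ?ltxx.
rewrite rank_maximal // => y; rewrite le_eqVlt => /predU1P[//|].
by case/exists_covers_above => w; rewrite [covers _ _]max_x.
Qed.

Lemma rank_predK x : ((rank x).-1.+1 = rank x)%N.
Proof. exact: prednK (rank_gt0 x). Qed.

Lemma rank_pred_lt x : ((rank x).-1 < height T)%N.
Proof. by rewrite rank_predK rank_le_height. Qed.

Lemma sum_covers_rank (V : nmodType) (g : T -> T -> V) r :
  (\sum_(x | rank x == r) \sum_(y | covers x y) g x y =
   \sum_(y | rank y == r.+1) \sum_(x | covers x y) g x y)%R.
Proof.
rewrite (exchange_big_dep (fun y => rank y == r.+1)) /= => [|x y /eqP<- /rank_covers->//].
apply: eq_bigr => y /eqP ry; apply: eq_bigl => x.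
apply: andb_idl => /rank_covers; rewrite ry => -[->]; exact: eqxx.
Qed.

Local Open Scope ring_scope.

Lemma sum_rank_const (V : nmodType) (g : T -> V) r c :
  (forall x, rank x = r -> g x = c) ->
  \sum_(x | rank x == r) g x = c *+ whitney T r.
Proof.
move=> gc; rewrite (eq_bigr (fun=> c)) => [|x /eqP/gc //].
by rewrite sumr_const; congr (_ *+ _); apply: eq_card => x; rewrite inE.
Qed.

(** Double counting of the flow between two consecutive ranks. With values in any additive monoid it
    serves real flows and integer counts alike. *)
Lemma whitney_flow (V : nmodType) (g : T -> T -> V) r c c' :
  (forall x, rank x = r -> \sum_(y | covers x y) g x y = c) ->
  (forall y, rank y = r.+1 -> \sum_(x | covers x y) g x y = c') ->
  c *+ whitney T r = c' *+ whitney T r.+1.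
Proof.
by move=> gc gc'; rewrite -(sum_rank_const gc) sum_covers_rank (sum_rank_const gc').
Qed.

(** * From a normalized flow to the LYM inequality *)

Section Flow.
Variables (R : realType) (f : T -> T -> R).

(* Probability that the descending random walk from x, which moves from y to
   w with probability proportional to f w y, meets A within its first k
   positions. *)
Fixpoint hit (A : {set T}) k x : R :=
  if k is k'.+1 then
    (x \in A)%:R +
    \sum_(w | covers w x) f w x / (\sum_(v | covers v x) f v x) * hit A k' w
  else 0.

Hypothesis f_ge0 : forall x y, covers x y -> 0 <= f x y.

Lemma hit_ge0 A k x : 0 <= hit A k x.
Proof.
elim: k x => //= k IHk x; rewrite addr_ge0 ?ler0n ?sumr_ge0 // => w wx.
by rewrite mulr_ge0 ?IHk ?divr_ge0 ?f_ge0 ?sumr_ge0 // => v; apply: f_ge0.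
Qed.

(** The walk only descends, so all its positions are at most [x]. *)
Lemma hit_eq0 (A : {set T}) k x :
  (forall a, a \in A -> ~~ (a <= x)%O) -> hit A k x = 0.
Proof.
elim: k x => //= k IHk x nA; rewrite big1 => [|w /andP[wx _]].
  by rewrite addr0 (contraTF (nA x)) ?lexx.
rewrite IHk ?mulr0 // => a /nA; apply: contra => /le_trans; apply; exact: ltW.
Qed.

(** The recursion adds up expected visits to [A]. A walk that has met an antichain continues
    strictly below that point and cannot meet it again. *)
Lemma hit_le1 (A : {set T}) k x : antichain A -> hit A k x <= 1.
Proof.
move=> antiA; elim: k x => [|k IHk] x /=; first exact: ler01.
have [xA|xA] := boolP (x \in A).
  rewrite big1 ?addr0 // => w /andP[wx _]; rewrite hit_eq0 ?mulr0 // => a aA.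
  apply/negP => aw; have ax := le_lt_trans aw wx.
  by move: (ax); rewrite (antiA a x aA xA (ltW ax)) ltxx.
rewrite add0r; set S := \sum_(v | covers v x) f v x.
have S_ge0 : 0 <= S by apply: sumr_ge0 => v; apply: f_ge0.
apply: (@le_trans _ _ (\sum_(w | covers w x) f w x / S)).
  by apply: ler_sum => w wx; rewrite ler_piMr ?divr_ge0 ?f_ge0.
(* At a minimal element [S] is 0, and then so is [S / S]. *)
rewrite -mulr_suml -/S; have [->|S_neq0] := eqVneq S 0; first by rewrite mul0r ler01.
by rewrite divff.
Qed.

Hypothesis flow_f : normalized_flow f.

(* The law of the walk started uniformly on rank r is uniform on every lower
   rank, so the expected number of visits to A is a sum of densities. *)
Lemma sum_hit (A : {set T}) r : (r < height T)%N ->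
  (\sum_(x | rank x == r.+1) hit A r.+1 x) / (whitney T r.+1)%:R =
  \sum_(x in A | (rank x <= r.+1)%N) ((whitney T (rank x))%:R)^-1.
Proof.
have sumA s : (\sum_(x | rank x == s) (x \in A)%:R) / (whitney T s)%:R =
    \sum_(x in A | rank x == s) ((whitney T (rank x))%:R)^-1 :> R.
  rewrite mulr_suml [RHS]big_mkcondl; apply: eq_bigr => x /eqP->.
  by case: (x \in A); rewrite ?mul1r ?mul0r.
(* The [r.+1] positions counted suffice to descend from rank [r.+1] to rank 1. *)
elim: r => [|r IHr] ltr.
  rewrite (eq_bigr (fun x => (x \in A)%:R)) => [|x _]; last first.
    by rewrite /= big1 ?addr0 // => w _; rewrite mulr0.
  rewrite sumA; apply: eq_bigl => x; congr (_ && _).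
  by rewrite eqn_leq rank_gt0 andbT.
have ltr' : (1 <= r.+1 <= (height T).-1)%N by rewrite ltn_predRL.
have [_ /(_ _ ltr')[c c_gt0 fc] /(_ _ ltr')[c' c'_gt0 fc']] := flow_f.
have := whitney_flow fc fc'; rewrite -[c *+ _]mulr_natl -[c' *+ _]mulr_natl => eqW.
(* One step of the walk: every denominator is the common inflow [c'], and exchanging the sums makes
   the common outflow [c] appear. *)
have step : \sum_(x | rank x == r.+2) \sum_(w | covers w x)
      f w x / (\sum_(v | covers v x) f v x) * hit A r.+1 w =
    c / c' * \sum_(x | rank x == r.+1) hit A r.+1 x.
  transitivity (\sum_(x | rank x == r.+2) \sum_(w | covers w x)
      f w x / c' * hit A r.+1 w).
    by apply: eq_bigr => x /eqP/fc'->.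
  rewrite -sum_covers_rank mulr_sumr; apply: eq_bigr => x /eqP/fc <-.
  by rewrite -mulr_suml -mulr_suml.
have [c0 c'0] : c != 0 /\ c' != 0 by rewrite !gt_eqF.
(* This is the flow identity [eqW]; if rank [r.+1] is empty, so is rank [r.+2], and both sides are
   0. *)
have ratio : c / c' / (whitney T r.+2)%:R = ((whitney T r.+1)%:R)^-1.
  have -> : (whitney T r.+2)%:R = (whitney T r.+1)%:R * c / c' by rewrite eqW mulfK.
  have [->|W0] := eqVneq ((whitney T r.+1)%:R : R) 0; first by rewrite !mul0r invr0 mulr0.
  by field; apply/and3P; split.
rewrite [LHS](_ : _ = (\sum_(x | rank x == r.+2) (x \in A)%:R) / (whitney T r.+2)%:R
   + (\sum_(x | rank x == r.+1) hit A r.+1 x) / (whitney T r.+1)%:R); last first.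
  rewrite (eq_bigr (fun x => _ + _) (fun x _ => erefl)) big_split /= mulrDl step.
  by rewrite -ratio; congr (_ + _); ring.
rewrite sumA IHr 1?ltnW // addrC.
rewrite [RHS](bigID (fun x => (rank x <= r.+1)%N)) /=; congr (_ + _).
  by apply: eq_bigl => x; case: (x \in A) => //=; lia.
by apply: eq_bigl => x; case: (x \in A) => //=; lia.
Qed.

(** For the walk started uniformly on the top rank, the sum is the expected number of visits to
    [A]. *)
Lemma flow_LYM (A : {set T}) : antichain A ->
  \sum_(x in A) ((whitney T (rank x))%:R)^-1 <= 1 :> R.
Proof.
(* Height 0 leaves no element, since ranks are at least 1. *)
move=> antiA; case Eh: (height T) => [|h].
  rewrite big1 ?ler01 // => x _.
  by have := leq_trans (rank_gt0 x) (rank_le_height x); rewrite Eh.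
rewrite (eq_bigl (fun x => (x \in A) && (rank x <= h.+1)%N)) => [|x]; last first.
  by rewrite -Eh rank_le_height andbT.
rewrite -sum_hit ?Eh //.
apply: (@le_trans _ _ ((whitney T h.+1)%:R / (whitney T h.+1)%:R)).
  rewrite ler_wpM2r ?invr_ge0 ?ler0n //.
  rewrite -(@sum_rank_const _ (fun=> 1)) //.
  by apply: ler_sum => x _; apply: hit_le1.
have [->|W0] := eqVneq ((whitney T h.+1)%:R : R) 0; first by rewrite mul0r ler01.
by rewrite divff.
Qed.

End Flow.
End GradedPosetFlow.

(** * From the LYM inequality to the strong Sperner property *)

(* For an optimal S every W s with s in S is at least w, the largest value of
   W outside S, so (W i - w) * ([i in S] - a i / W i) >= 0 for all i. *)
Lemma sum_le_top (R : realType) (I : finType) (W a : I -> nat) (k : nat) :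
  (k <= #|I|)%N -> (forall i, (a i <= W i)%N) ->
  (\sum_i (a i)%:R / (W i)%:R <= k%:R :> R)%R ->
  (\sum_i a i <= \max_(S : {set I} | #|S| == k) \sum_(i in S) W i)%N.
Proof.
move=> leks leaW le_rho.
pose P (S : {set I}) := #|S| == k.
have [S0 S0k] : exists S, P S.
  have : (0 < #|[set A : {set I} | #|A| == k]|)%N by rewrite card_draws bin_gt0.
  by case/card_gt0P => S; rewrite inE => Sk; exists S.
case: (arg_maxnP (fun S : {set I} => \sum_(i in S) W i) S0k) => S Sk Smax.
rewrite /P in Sk Smax; apply: leq_trans (leq_bigmax_cond _ Sk).
pose w := \max_(i in ~: S) W i.
have leW i : i \notin S -> (W i <= w)%N.
  by move=> iS; apply: (leq_bigmax_cond (F := W)); rewrite inE.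
(* Exchanging [s] for some [t] outside [S] cannot increase the optimal weight. *)
have leS s : s \in S -> (w <= W s)%N.
  move=> sS; apply/bigmax_leqP => t; rewrite inE => tS.
  have st : t \notin S :\ s by rewrite !inE (negbTE tS) andbF.
  have := Smax (t |: S :\ s).
  rewrite cardsU1 st; rewrite (cardsD1 s) sS in Sk => /(_ Sk).
  by rewrite big_setU1 //= (big_setD1 s sS) leq_add2r.
(* Each [a i] becomes [W i] times its ratio, also when [W i] is 0, since then [a i] is 0. *)
rewrite -(ler_nat R) !natr_sum -subr_ge0 [X in (_ - X)%R](eq_bigr
  (fun i => (W i)%:R * ((a i)%:R / (W i)%:R))%R); last first.
  move=> i _; have [W0|W0] := eqVneq (W i) 0%N.
    by have := leaW i; rewrite W0 leqn0 => /eqP->; rewrite mul0r.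
  by rewrite mulrCA divff ?mulr1 ?pnatr_eq0.
rewrite big_mkcond -sumrB.
(* With every weight replaced by [w], the sum is [w] times the excess of [k] over the sum of the
   ratios, nonnegative by [le_rho]. *)
apply: (@le_trans _ _ (\sum_i (w%:R * ((i \in S)%:R - (a i)%:R / (W i)%:R)))%R).
  rewrite -mulr_sumr mulr_ge0 ?ler0n // sumrB subr_ge0 (le_trans le_rho) //.
  by rewrite -natr_sum ler_nat -(eqP Sk) -sum1_card big_mkcond /=
    leq_sum // => i _; case: (i \in S).
apply: ler_sum => i _.
have rho_ge0 : (0 <= (a i)%:R / (W i)%:R :> R)%R by rewrite divr_ge0.
have rho_le1 : ((a i)%:R / (W i)%:R <= 1 :> R)%R.
  have [W0|W0] := posnP (W i); first by rewrite W0 invr0 mulr0 ler01.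
  by rewrite ler_pdivrMr ?ltr0n // mul1r ler_nat.
have [iS|iS] := boolP (i \in S).
  have : (w%:R <= (W i)%:R :> R)%R by rewrite ler_nat leS.
  rewrite mulr1n => ws; have : (0 <= ((W i)%:R - w%:R) * (1 - (a i)%:R / (W i)%:R) :> R)%R.
    by rewrite mulr_ge0 ?subr_ge0.
  lra.
have : ((W i)%:R <= w%:R :> R)%R by rewrite ler_nat leW.
rewrite mulr0n => sw; have : (0 <= (w%:R - (W i)%:R) * ((a i)%:R / (W i)%:R) :> R)%R.
  by rewrite mulr_ge0 ?subr_ge0.
lra.
Qed.

Lemma flow_strongly_Sperner (R : realType) d (T : gradedPosetType d) :
  has_normalized_flow T R -> strongly_Sperner T.
Proof.
move=> [f flow_f] j _ A antiA; have [f_ge0 _ _] := flow_f.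
set F := \bigcup_(i < j) A i.
pose a r := #|[set x in F | rank x == r]|.
(* Used both for counting [F] and for summing real densities over it. *)
have sum_ranks (V : nmodType) (g : T -> V) : (\sum_(x in F) g x =
    \sum_(r < height T) \sum_(x in F | rank x == r.+1) g x)%R.
  rewrite (partition_big (fun x => Ordinal (rank_pred_lt x)) xpredT) //=.
  apply: eq_bigr => r _; apply: eq_bigl => x; congr (_ && _).
  by rewrite -val_eqE /= -[in RHS]rank_predK eqSS.
have -> : #|F| = \sum_(r < height T) a r.+1.
  rewrite -sum1_card sum_ranks; apply: eq_bigr => r _.
  by rewrite sum1dep_card /a; apply: eq_card => x; rewrite !inE.
have leaW r : (a r <= whitney T r)%N.
  by apply/subset_leq_card/subsetP => x; rewrite !inE => /andP[].
apply: (@sum_le_top R) => //; first by rewrite card_ord geq_minr.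
have sumF : (\sum_(r < height T) (a r.+1)%:R / (whitney T r.+1)%:R =
    \sum_(x in F) (whitney T (rank x))%:R^-1 :> R)%R.
  rewrite sum_ranks; apply: eq_bigr => r _.
  rewrite (eq_bigr (fun=> (whitney T r.+1)%:R^-1)%R) => [|x /andP[_ /eqP-> //]].
  rewrite sumr_const mulr_natl; congr (_ *+ _)%R.
  by apply: eq_card => x; rewrite !inE.
(* The bound [height T] holds because each ratio is at most 1; the bound [j] comes from LYM applied
   to each antichain. *)
rewrite natr_min le_min; apply/andP; split; last first.
  rewrite -[X in (_ <= X%:R)%R]card_ord -sumr_const; apply: ler_sum => r _.
  have [W0|W0] := posnP (whitney T r.+1); first by rewrite W0 invr0 mulr0 ler01.
  by rewrite ler_pdivrMr ?ltr0n // mul1r ler_nat.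
rewrite sumF; apply: (@le_trans _ _
    (\sum_(i < j) \sum_(x in A i) (whitney T (rank x))%:R^-1)%R).
  rewrite (exchange_big_dep (mem F)) /= => [|i x _ xA]; last by apply/bigcupP; exists i.
  apply: ler_sum => x /bigcupP[i _ xA]; rewrite (bigD1 i) //= lerDl sumr_ge0 // => k _.
  by rewrite invr_ge0.
rewrite -[X in (_ <= X%:R)%R]card_ord -sumr_const; apply: ler_sum => i _.
exact: flow_LYM f_ge0 flow_f _ (antiA i).
Qed.

(** * Supports and cover relations of the block poset *)

Section RposetFlow.
Context {n l : nat}.
Implicit Types (A B : Rposet n l) (s t b : 'I_n).

Definition support A : {set 'I_n} := \bigcup_i A i.

Lemma supportP A b : reflect (exists i, b \in A i) (b \in support A).
Proof. by apply: (iffP bigcupP) => [[i _]|[i]]; exists i. Qed.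

Lemma card_support A : #|support A| = rank A + l.
Proof. by rewrite [rank A]/(#|support A| - l) subnK // ltnW // card_blocks_gt. Qed.

Lemma blocks_lt A (i j : 'I_l.+1) (x y : 'I_n) : (i < j)%N -> x \in A i -> y \in A j -> (x < y)%N.
Proof. by have [_] := block_tupleP _ (blocksP A); move=> /[apply]; apply. Qed.

Lemma blocks_neq0 A i : A i != set0.
Proof. by have [] := block_tupleP _ (blocksP A). Qed.

(** The blocks of [B] are disjoint and contain those of [A]; hence, below a fixed [B], an element is
    determined by its support. *)
Lemma le_blocksE A B i : (A <= B)%O -> A i = B i :&: support A.
Proof.
move=> /Rposet_leP sAB; apply/setP => x; rewrite inE; apply/idP/andP => [xA|].
  by split; [apply: subsetP (sAB i) _ xA | apply/supportP; exists i].
by case=> xB /supportP[j xA]; rewrite (block_inj xB (subsetP (sAB j) _ xA)).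
Qed.

Lemma support_subset A B : (A <= B)%O -> support A \subset support B.
Proof.
move=> /Rposet_leP sAB; apply/subsetP => x /supportP[i xA].
by apply/supportP; exists i; apply: subsetP (sAB i) _ xA.
Qed.

Lemma le_support_inj A A' B :
  (A <= B)%O -> (A' <= B)%O -> support A = support A' -> A = A'.
Proof.
move=> AB A'B eqU; apply/val_inj/ffunP => i.
by rewrite /= (le_blocksE i AB) (le_blocksE i A'B) eqU.
Qed.

Lemma lt_card_support A B : (A < B)%O -> (#|support A| < #|support B|)%N.
Proof.
move=> ltAB; have leAB := ltW ltAB; apply: proper_card.
rewrite properEneq support_subset // andbT; apply: contraTneq ltAB => eqU.
by rewrite (le_support_inj leAB (lexx B) eqU) ltxx.
Qed.

(** A strict inequality strictly enlarges the support, so a gain of one point leaves no room in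
    between. *)
Lemma coversE A B : covers A B = (A <= B)%O && (#|support B| == #|support A|.+1).
Proof.
apply/idP/andP => [AB|[leAB /eqP eqc]].
  rewrite !card_support (rank_covers _ _ AB) addSn eqxx; split=> //.
  by case/andP: AB => /ltW.
rewrite /covers lt_neqAle leAB andbT; apply/andP; split.
  by apply/eqP => eqAB; move: eqc; rewrite eqAB; lia.
apply/forallP => C; apply/negP => /andP[/lt_card_support AC /lt_card_support CB].
lia.
Qed.

Lemma covers_block A B b i : covers A B -> b \notin support A -> b \in B i ->
  forall j, B j = if j == i then b |: A j else A j.
Proof.
rewrite coversE => /andP[leAB /eqP eqc] bA bB.
have bU : b \in support B by apply/supportP; exists i.
have UB : support B = b |: support A.
  apply/eqP; rewrite eq_sym eqEcard cardsU1 bA eqc subUset sub1set bU.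
  by rewrite support_subset //= add1n.
move=> j; apply/setP => x.
have xA : (x \in A j) = (x \in B j) && (x \in support A).
  by rewrite (le_blocksE j leAB) inE.
have xBU : x \in B j -> x \in b |: support A.
  by move=> xB; rewrite -UB; apply/supportP; exists j.
have [exb|xb] := eqVneq x b.
  have [->|ji] := eqVneq j i; first by rewrite exb bB setU11.
  rewrite xA exb (negbTE bA) andbF.
  by apply: contraNF ji => bj; rewrite (block_inj bj bB).
have -> : (x \in if j == i then b |: A j else A j) = (x \in A j).
  by case: ifP; rewrite ?inE ?(negbTE xb).
by rewrite xA; case: (boolP (x \in B j)) => //= /xBU; rewrite in_setU1 (negbTE xb) /= => ->.
Qed.

Lemma covers_insert A b (i : 'I_l.+1) : b \notin support A ->
  (forall (j : 'I_l.+1) (x : 'I_n), (j < i)%N -> x \in A j -> (x < b)%N) ->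
  (forall (j : 'I_l.+1) (x : 'I_n), (i < j)%N -> x \in A j -> (b < x)%N) ->
  exists2 B, covers A B & b \in B i.
Proof.
move=> bA ltb gtb; pose F := [ffun j => if j == i then b |: A j else A j].
have AF j : A j \subset F j by rewrite ffunE; case: ifP => // _; apply: subsetU1.
have FP : block_tuple F.
  apply/block_tupleP; split=> [j|j k jk x y].
    have /set0Pn[x xj] := blocks_neq0 A j; apply/set0Pn; exists x.
    exact: subsetP (AF j) _ xj.
  rewrite !ffunE; case: eqVneq => [ji|_]; case: eqVneq => [ki|_].
  - by rewrite ji ki ltnn in jk.
  - rewrite ji in jk *; rewrite !inE => /predU1P[->|xi] yk; first exact: gtb jk yk.
    exact: blocks_lt jk xi yk.
  - rewrite ki in jk *; rewrite !inE => xj /predU1P[->|yi]; first exact: ltb jk xj.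
    exact: blocks_lt jk xj yi.
  - exact: blocks_lt jk.
exists (RPoset FP); last by rewrite /= ffunE eqxx setU11.
rewrite coversE; apply/andP; split; first by apply/Rposet_leP => j; apply: AF.
suff -> : support (RPoset FP) = b |: support A by rewrite cardsU1 bA.
apply/setP => x; rewrite !inE; apply/supportP/predU1P => [[j]|].
  rewrite /= ffunE; case: eqP => _; rewrite ?inE.
    by case/predU1P => [|xA]; [left | right; apply/supportP; exists j].
  by move=> xA; right; apply/supportP; exists j.
case=> [->|/supportP[j xA]]; first by exists i; rewrite /= ffunE eqxx setU11.
by exists j; apply: subsetP (AF j) _ xA.
Qed.

(** * The push flow and its total out of an element *)

(* For B covering A with new element b: s pushes b into the block, among those
   of its two neighbours in the support of A, of the one lying on its side. *)
Definition pushes A B s b : bool :=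
  [&& s \in support A, b \notin support A &
    [exists i, (b \in B i) && [exists t in A i, (t < b)%N == (s < b)%N]]].

Definition push_count A B : nat := \sum_s \sum_b pushes A B s b.

Lemma pushesP A B s b :
  reflect [/\ s \in support A, b \notin support A &
             exists i t, [/\ b \in B i, t \in A i & (t < b)%N = (s < b)%N]]
          (pushes A B s b).
Proof.
apply: (iffP and3P) => -[sA bA H]; split=> //.
  case/existsP: H => i /andP[bB /exists_inP[t tA /eqP]]; by exists i, t.
case: H => i [t [bB tA e]]; apply/existsP; exists i; rewrite bB.
by apply/exists_inP; exists t => //; apply/eqP.
Qed.

(** Insert [b] into the block of [t], the point of the support nearest to [b] on the side of [s]. *)
Lemma exists_pushes A s b : s \in support A -> b \notin support A ->
  exists2 B, covers A B & pushes A B s b.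
Proof.
move=> sA bA; pose P t := (t \in support A) && ((t < b)%N == (s < b)%N).
have Ps : P s by rewrite /P sA eqxx.
case: (arg_minnP (fun t => (t - b) + (b - t)) Ps) => t /andP[/supportP[i tA] /eqP tb] tmin.
have neqb j x : x \in A j -> x != b :> nat.
  by move=> xA; apply: contraNneq bA => /val_inj <-; apply/supportP; exists j.
have far j x : x \in A j -> (x < b)%N = (s < b)%N -> (t - b + (b - t) <= x - b + (b - x))%N.
  move=> xA xb; apply: tmin; rewrite /P xb eqxx andbT.
  by apply/supportP; exists j.
have [||B AB bB] := @covers_insert A b i bA; last first.
- by exists B => //; apply/pushesP; split=> //; exists i, t.
(* A point [x] of another block on the wrong side of [b] would lie between [t] and [b],
   contradicting the choice of [t]. *)
- move=> j x ij xA; have := blocks_lt ij tA xA; have := neqb _ _ xA.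
  by have := far _ _ xA; have := neqb _ _ tA; lia.
- move=> j x ji xA; have := blocks_lt ji xA tA; have := neqb _ _ xA.
  by have := far _ _ xA; have := neqb _ _ tA; lia.
Qed.

(** If the two receiving blocks differed, [t] and [u] would be on opposite sides of [b], yet both
    are on the side of [s]. *)
Lemma pushes_inj A B B' s b : covers A B -> covers A B' ->
  pushes A B s b -> pushes A B' s b -> B = B'.
Proof.
move=> AB AB' /pushesP[_ bA [i [t [bB tA tb]]]] /pushesP[_ _ [j [u [bB' uA ub]]]].
have [leAB leAB'] : (A <= B)%O /\ (A <= B')%O by move: AB AB' => /andP[/ltW ? _] /andP[/ltW].
have tB' : t \in B' i by apply: subsetP (Rposet_leP _ _ leAB' i) _ tA.
have uB : u \in B j by apply: subsetP (Rposet_leP _ _ leAB j) _ uA.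
have ij : i = j.
  have neqb k x : x \in A k -> x != b :> nat.
    by move=> xA; apply: contraNneq bA => /val_inj <-; apply/supportP; exists k.
  have := neqb _ _ tA; have := neqb _ _ uA.
  case: (ltngtP i j) => [ij|ij|/val_inj//]; exfalso.
    have := blocks_lt ij bB uB; have := blocks_lt ij tB' bB'; lia.
  have := blocks_lt ij uB bB; have := blocks_lt ij bB' tB'; lia.
apply/val_inj/ffunP => k; rewrite /= (covers_block AB bA bB) ij.
by rewrite (covers_block AB' bA bB').
Qed.

Lemma sum_push_count_above A :
  \sum_(B | covers A B) push_count A B = #|support A| * (n - #|support A|).
Proof.
rewrite exchange_big /= -sum_nat_const [RHS]big_mkcond; apply: eq_bigr => s _.
rewrite exchange_big /= (_ : n - _ = #|~: support A|); last by rewrite cardsCs setCK card_ord.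
case: ifPn => [sA|sA]; last first.
  by rewrite big1 // => b _; rewrite big1 // => B _; rewrite /pushes (negbTE sA).
rewrite -sum1_card [RHS]big_mkcond; apply: eq_bigr => b _; rewrite inE.
case: ifPn => [bA|]; last first.
  by rewrite negbK => bA; rewrite big1 // => B _; rewrite /pushes bA andbF.
have [B AB pB] := exists_pushes sA bA.
rewrite (bigD1 B) //= pB big1 // => B' /andP[AB' neqB].
case: (boolP (pushes _ _ _ _)) => // pB'.
by rewrite (pushes_inj AB' AB pB' pB) eqxx in neqB.
Qed.

(** * The total flow into an element *)

Lemma support_covers_below A B b : covers A B -> b \in support B ->
  b \notin support A -> support A = support B :\ b.
Proof.
rewrite coversE => /andP[leAB /eqP eqc] bB bA; apply/eqP.
rewrite eqEcard subsetD1 support_subset // bA /=.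
by move: eqc; rewrite (cardsD1 b (support B)) bB add1n => -[->].
Qed.

(** The only candidate for [A] is [B] with [b] deleted; the point [t] keeps the block nonempty and
    lets [s] push [b] back. *)
Lemma sum_pushes_below B s b i : b \in B i ->
  \sum_(A | covers A B) pushes A B s b =
  [&& s \in support B, s != b & [exists t in B i :\ b, (t < b)%N == (s < b)%N]].
Proof.
move=> bB; have bU : b \in support B by apply/supportP; exists i.
case: (boolP [&& _, _ & _]) => [/and3P[sU sb /exists_inP[t]]|nogood].
  rewrite !inE => /andP[tb tB] /eqP tsb.
  have nb : B i != [set b] by apply: contraNneq tb => Bi; rewrite Bi inE in tB.
  have [A ltAB AE] := Rposet_del bB nb.
  have UA : support A = support B :\ b.
    apply/setP => x; rewrite !inE; apply/supportP/andP.
      by case=> j; rewrite AE !inE => /andP[-> xB]; split=> //; apply/supportP; exists j.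
    by case=> xb /supportP[j xB]; exists j; rewrite AE !inE xb.
  have AB : covers A B by rewrite coversE ltW //= UA (cardsD1 b (support B)) bU.
  have pA : pushes A B s b.
    apply/pushesP; rewrite UA !inE eqxx sb sU; split=> //.
    by exists i, t; rewrite AE !inE tb tB.
  rewrite (bigD1 A) //= pA big1 // => A' /andP[AB' neqA].
  case: (boolP (pushes _ _ _ _)) => // /and3P[_ bA' _].
  case/eqP: neqA; apply: (@le_support_inj _ _ B).
  - by case/andP: AB' => /ltW.
  - exact: ltW.
  - by rewrite UA (support_covers_below AB' bU bA').
rewrite big1 // => A AB; case: (boolP (pushes _ _ _ _)) => // /pushesP.
case=> sA bA [j [t [bj tA tsb]]]; case/negP: nogood.
have leAB : (A <= B)%O by case/andP: AB => /ltW.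
rewrite (subsetP (support_subset leAB)) //=; apply/andP; split.
  by apply: contraNneq bA => <-.
have ij := block_inj bB bj; apply/exists_inP; exists t; last exact/eqP.
rewrite !inE ij (subsetP (Rposet_leP _ _ leAB j)) // andbT.
by apply: contraNneq bA => <-; apply/supportP; exists j.
Qed.

(* Deleting b lets s push it back except when b is the element of B i nearest
   to s. *)
Lemma sum_pushes_block B s i : s \in support B ->
  \sum_(b in B i) \sum_(A | covers A B) pushes A B s b = #|B i|.-1.
Proof.
move=> sU; have /supportP[j sB] := sU.
have /set0Pn[b0 b0B] := blocks_neq0 B i.
case: (arg_minnP (fun b => (s - b) + (b - s)) b0B) => c cB cmin.
have cmin' b : b \in B i -> (s - c + (c - s) <= s - b + (b - s))%N by apply: cmin.
rewrite (cardsD1 c (B i)) (cB : c \in B i) -sum1_card (big_setD1 c cB) /= (sum_pushes_below _ cB).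
rewrite -[RHS]add0n; congr (_ + _).
  (* The nearest point [c] contributes 0: if [s] is in [B i] then [c] is [s]; otherwise the rest of
     [B i] lies beyond [c] as seen from [s]. *)
  apply/eqP; rewrite eqb0; apply/negP => /and3P[_ sc /exists_inP[t]].
  rewrite !inE => /andP[tc tB] /eqP tsc; have := cmin' t tB.
  have := cmin' s; have : s != c :> nat by []; have : t != c :> nat by [].
  case: (ltngtP i j) => ij.
  - by have := blocks_lt ij cB sB; have := blocks_lt ij tB sB; lia.
  - by have := blocks_lt ij sB cB; have := blocks_lt ij sB tB; lia.
  - by rewrite (val_inj ij : i = j) => ?? /(_ sB); lia.
(* Any other [b] contributes 1, with [c] as the remaining point on the side of [s]. *)
apply: eq_bigr => b; rewrite !inE => /andP[bc bB]; rewrite (sum_pushes_below _ bB) sU /=.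
apply/eqP; rewrite eqb1; have := cmin' b bB.
have nbc : b != c :> nat by [].
case: (ltngtP i j) => ij.
- have := blocks_lt ij cB sB; have := blocks_lt ij bB sB => ? ? ?.
  apply/andP; split; first by apply/eqP => /(congr1 val) /=; lia.
  by apply/exists_inP; exists c; [rewrite !inE eq_sym bc | apply/eqP; lia].
- have := blocks_lt ij sB cB; have := blocks_lt ij sB bB => ? ? ?.
  apply/andP; split; first by apply/eqP => /(congr1 val) /=; lia.
  by apply/exists_inP; exists c; [rewrite !inE eq_sym bc | apply/eqP; lia].
have := cmin' s; rewrite {1}(val_inj ij : i = j) => /(_ sB) sc _.
have sc' : s = c by apply: val_inj => /=; lia.
rewrite sc' (eq_sym c b) bc; apply/exists_inP; exists c; last exact: eqxx.
by rewrite !inE eq_sym bc.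
Qed.

Lemma sum_push_count_below B :
  \sum_(A | covers A B) push_count A B = #|support B| * (#|support B| - l.+1).
Proof.
rewrite exchange_big /= -sum_nat_const [RHS]big_mkcond; apply: eq_bigr => s _.
rewrite exchange_big /=; case: ifPn => [sU|sU]; last first.
  rewrite big1 // => b _; rewrite big1 // => A /andP[/ltW leAB _].
  by rewrite /pushes (contraNF (subsetP (support_subset leAB) s) sU).
rewrite (bigID (mem (support B))) /= addnC big1 => [|b bB]; last first.
  rewrite big1 // => A _; case: (boolP (pushes _ _ _ _)) => // /pushesP[_ _ [i [t [bBi _ _]]]].
  by case/negP: bB; apply/supportP; exists i.
rewrite add0n partition_disjoint_bigcup /= => [|i j ij]; last first.
  rewrite -setI_eq0; apply/set0Pn => -[x /setIP[xi xj]].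
  by rewrite (block_inj xi xj) eqxx in ij.
rewrite (eq_bigr (fun i => #|B i| - 1)) => [|i _]; last by rewrite sum_pushes_block ?subn1.
rewrite sumnB => [|i _]; last by rewrite card_gt0 blocks_neq0.
by rewrite sum1_card card_ord -card_blocks.
Qed.

(** * Whitney numbers, log-concavity and the normalized flow *)

Lemma sum_push_count_above_rank r A : rank A = r ->
  \sum_(B | covers A B) push_count A B = (r + l) * (n - (r + l)).
Proof. by move=> rA; rewrite sum_push_count_above card_support rA. Qed.

Lemma sum_push_count_below_rank r B : rank B = r.+1 ->
  \sum_(A | covers A B) push_count A B = (r + l).+1 * r.
Proof.
move=> rB; rewrite sum_push_count_below card_support rB addSn subSS.
by rewrite addnK.
Qed.

Lemma whitney_ratio r :
  whitney (Rposet n l) r * ((r + l) * (n - (r + l))) =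
  whitney (Rposet n l) r.+1 * ((r + l).+1 * r).
Proof.
have mulnE (c k : nat) : (c *+ k)%R = k * c.
  by elim: k => // k IHk; rewrite mulrS IHk mulSn.
rewrite -[LHS]mulnE -[RHS]mulnE; apply: (whitney_flow (g := push_count)) => A.
  exact: sum_push_count_above_rank.
exact: sum_push_count_below_rank.
Qed.

Lemma Rposet_log_concave : rank_log_concave (Rposet n l).
Proof.
case=> // [[|k]] // /andP[_]; rewrite [height _]/(n - l) /= => lek.
have := whitney_ratio k.+1; have := whitney_ratio k.+2.
set W1 := whitney _ k.+1; set W2 := whitney _ k.+2; set W3 := whitney _ k.+3.
(* [N] counts the points outside a support of rank [k.+3]. *)
have [N ->] : exists N, n = N + (k.+2 + l).+1 by exists (n - (k.+2 + l).+1); lia.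
rewrite (_ : N + (k.+2 + l).+1 - (k.+2 + l) = N.+1); last lia.
rewrite (_ : N + (k.+2 + l).+1 - (k.+1 + l) = N.+2); last lia.
move=> e2 e1.
(* The product of the coefficients of [W1] in [e1] and of [W3] in [e2]. *)
pose c := (k.+1 + l) * N.+2 * ((k.+2 + l).+1 * k.+2).
have c_gt0 : 0 < c by rewrite /c !muln_gt0.
rewrite -(leq_pmul2r c_gt0).
have -> : W1 * W3 * c = W2 ^ 2 * ((k.+1 + l).+1 * k.+1 * ((k.+2 + l) * N.+1)).
  transitivity ((W1 * ((k.+1 + l) * N.+2)) * (W3 * ((k.+2 + l).+1 * k.+2))).
    by rewrite /c; ring.
  by rewrite e1 -e2; ring.
(* With [p = k + 2 + l] this reads [p^2 (k+1) (N+1) <= (p^2 - 1) (k+2) (N+2)], which follows from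
   [k + 2 <= p^2]. *)
rewrite leq_mul2l; apply/orP; right; rewrite /c; nia.
Qed.

(** Both totals depend on the rank only, and they are positive because [0 < r + l < n] for the ranks
    [r] concerned. *)
Lemma Rposet_flow (R : realType) :
  normalized_flow (fun A B : Rposet n l => (push_count A B)%:R : R)%R.
Proof.
split=> [A B _|r rh|r rh]; first exact: ler0n.
  exists ((r + l) * (n - (r + l)))%:R%R.
    by move: rh; rewrite [height _]/(n - l) ltr0n muln_gt0; lia.
  by move=> A rA; rewrite -natr_sum (sum_push_count_above_rank rA).
exists ((r + l).+1 * r)%:R%R.
  by rewrite ltr0n muln_gt0; case/andP: rh.
by move=> B rB; rewrite -natr_sum (sum_push_count_below_rank rB).
Qed.

End RposetFlow.

Theorem theorem1p3 (R : realType) (n l : nat) (hln : (l < n)%N) :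
  [/\ rank_log_concave (Rposet n l),
      has_normalized_flow (Rposet n l) R
    & strongly_Sperner (Rposet n l)].
Proof.
have flow : has_normalized_flow (Rposet n l) R.
  by exists (fun A B => (push_count A B)%:R)%R; apply: Rposet_flow.
split=> //; first exact: Rposet_log_concave.
exact: flow_strongly_Sperner flow.
Qed.
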